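(* Let $\mathcal{A}$ be a random set in $\mathcal{B}(n,\alpha)$, let $X := \deg \operatorname{lcm}\big([\mathcal{A}]_q\big)$, and let $f(\alpha) := \frac{3}{\pi^2}\cdot\frac{\alpha\,\mathrm{Li}_2(1-\alpha)}{1-\alpha}$ for $\alpha\in(0,1)$ and $f(1):=\frac{3}{\pi^2}$, where $\mathrm{Li}_2(z) := \sum_{k\geq 1} z^k/k^2$. Then, as $\alpha n \to +\infty$, $X \sim f(\alpha)\, n^2$ with probability $1-o(1)$; that is, for every $\varepsilon>0$ and $\delta>0$ there exists $M>0$ such that for all positive integers $n$ and all $\alpha\in(0,1]$ with $\alpha n \geq M$, \[ \mathbb{P}\big[\, |X - f(\alpha) n^2| > \varepsilon f(\alpha) n^2 \,\big] \leq \delta . \]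
   Context: For a positive integer $n$ and $\alpha\in[0,1]$, $\mathcal{B}(n,\alpha)$ denotes the probabilistic model in which a random set $\mathcal{A}\subseteq\{1,\dots,n\}$ is constructed by including each element of $\{1,\dots,n\}$ independently with probability $\alpha$. For an indeterminate $q$ and a positive integer $k$, $[k]_q := 1+q+\cdots+q^{k-1}\in\mathbb{Z}[q]$, and for a set $\mathcal{S}$ of positive integers $[\mathcal{S}]_q := \{[k]_q : k\in\mathcal{S}\}$. The least common multiple is taken in $\mathbb{Q}[q]$ (monic), with $\operatorname{lcm}(\varnothing)=1$ of degree $0$. *)

(* Defs.v *)
From HB Require Import structures.
From mathcomp Require Import all_boot all_order all_algebra.
From mathcomp Require Import all_classical all_reals all_analysis.
Set Implicit Arguments. Unset Strict Implicit. Unset Printing Implicit Defensive.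
Import Order.TTheory GRing.Theory Num.Theory.
Import numFieldNormedType.Exports.
Local Open Scope ring_scope.

Definition qint (k : nat) : {poly rat} := \sum_(i < k) 'X^i.

Definition lcmp (p q : {poly rat}) : {poly rat} :=
  let l := (p * q) %/ gcdp p q in (lead_coef l)^-1 *: l.

Definition lcm_seqp (s : seq {poly rat}) : {poly rat} := foldr lcmp 1 s.

(* A subset S of 'I_n encodes the subset {i+1 | i in S} of {1,...,n}.
   X S = deg lcm([A]_q) with A = {i+1 | i in S}. *)
Definition Xdeg (n : nat) (S : {set 'I_n}) : nat :=
  (size (lcm_seqp [seq qint (nat_of_ord i).+1 | i <- enum S])).-1.

Definition bprob (R : realType) (n : nat) (alpha : R) (E : pred {set 'I_n}) : R :=
  \sum_(S : {set 'I_n} | E S) alpha ^+ #|S| * (1 - alpha) ^+ (n - #|S|).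

Definition Li2 (R : realType) (z : R) : R :=
  limn (series (fun k : nat => z ^+ k.+1 / (k.+1)%:R ^+ 2)).

Definition fdens (R : realType) (alpha : R) : R :=
  if alpha == 1 then 3 / pi ^+ 2
  else 3 / pi ^+ 2 * (alpha * Li2 (1 - alpha) / (1 - alpha)).

(* Main.v *)
(* With N = n!, every [k]_q with k <= n divides q^N - 1, which is separable, so
   X counts the N-th roots of unity z <> 1 such that z^k = 1 for some k in A.
   Thus X is a sum of indicators of events "A meets D_z", and their covariances
   are at most alpha * |D_z :&: D_w|; summing over z and w for each fixed point k
   first gives Var X <= alpha n^3, and Chebyshev's inequality applies.
   The mean is alpha * sum_(j < n) (1 - alpha)^j (Phi(n / (j+1)) - 1), where
   Phi(m) is the number of reduced fractions in [0, 1) with denominator <= m.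
   The asymptotics Phi(m) ~ (3 / pi^2) m^2 follow from the identity
   sum_(j <= m) Phi(m / j) = m (m + 1) / 2 by a contraction argument: an error
   bound eta m^2 + O(1) improves itself to (7/8) eta m^2 + O(1), because
   sum_(j >= 2) 1 / j^2 <= 3 / 4. *)

Require Import Defs.
From HB Require Import structures.
From mathcomp Require Import all_boot all_order all_algebra all_field.
From mathcomp Require Import all_classical all_reals all_analysis.
From mathcomp Require Import ring lra zify.
Import Order.TTheory GRing.Theory Num.Theory.
Import numFieldNormedType.Exports.
Set Implicit Arguments. Unset Strict Implicit. Unset Printing Implicit Defensive.
Local Open Scope ring_scope.

(** * Degree of the lcm *)

(** Stated up to a unit, which absorbs the monic normalisation. The divisibility facts below follow
    by cancelling the gcd. *)
Lemma lcmp_mul_gcdp (p q : {poly rat}) : p != 0 -> q != 0 ->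
  lcmp p q * gcdp p q %= p * q.
Proof.
move=> p0 q0; rewrite /lcmp /=; set l := (p * q) %/ gcdp p q.
have gpq : gcdp p q %| p * q by rewrite dvdp_mulr // dvdp_gcdl.
have l0 : l != 0 by rewrite dvdp_div_eq0 // mulf_neq0.
rewrite -scalerAl divpK //; apply: eqp_scale.
by rewrite invr_eq0 lead_coef_eq0.
Qed.

Lemma lcmp_neq0 (p q : {poly rat}) : p != 0 -> q != 0 -> lcmp p q != 0.
Proof.
move=> p0 q0; have := eqp_size (lcmp_mul_gcdp p0 q0).
by apply: contra_eqN => /eqP->; rewrite mul0r size_poly0 eq_sym size_poly_eq0 mulf_neq0.
Qed.

Lemma dvdp_lcmpl (p q : {poly rat}) : p != 0 -> q != 0 -> p %| lcmp p q.
Proof.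
move=> p0 q0; have g0 : gcdp p q != 0 by rewrite gcdp_eq0 negb_and p0.
rewrite -(dvdp_mul2r _ _ g0) (eqp_dvdr _ (lcmp_mul_gcdp p0 q0)).
by rewrite dvdp_mul // dvdp_gcdr.
Qed.

Lemma dvdp_lcmpr (p q : {poly rat}) : p != 0 -> q != 0 -> q %| lcmp p q.
Proof.
move=> p0 q0; have g0 : gcdp p q != 0 by rewrite gcdp_eq0 negb_and p0.
rewrite -(dvdp_mul2r _ _ g0) (eqp_dvdr _ (lcmp_mul_gcdp p0 q0)) mulrC.
by rewrite dvdp_mul // dvdp_gcdl.
Qed.

Lemma lcmp_dvdp (p q d : {poly rat}) : p != 0 -> q != 0 ->
  p %| d -> q %| d -> lcmp p q %| d.
Proof.
move=> p0 q0 pd qd; have g0 : gcdp p q != 0 by rewrite gcdp_eq0 negb_and p0.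
rewrite -(dvdp_mul2r _ _ g0) (eqp_dvdl _ (lcmp_mul_gcdp p0 q0)).
have [->|d0] := eqVneq d 0; first by rewrite mul0r dvdp0.
rewrite (eqp_dvdr _ (mulp_gcdr p q d)) dvdp_gcd.
by rewrite [p * q]mulrC dvdp_mul2r // qd [q * p]mulrC dvdp_mul2r.
Qed.

Lemma lcm_seqp_neq0 (s : seq {poly rat}) :
  (forall p, p \in s -> p != 0) -> lcm_seqp s != 0.
Proof.
elim: s => [|p s IHs] s0 /=; first exact: oner_neq0.
apply: lcmp_neq0; first by rewrite s0 ?mem_head.
by apply: IHs => q qs; rewrite s0 // inE qs orbT.
Qed.

Lemma lcm_seqp_dvdp (s : seq {poly rat}) d :
  (forall p, p \in s -> p != 0) -> (forall p, p \in s -> p %| d) ->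
  lcm_seqp s %| d.
Proof.
elim: s => [|p s IHs] s0 sd /=; first exact: dvd1p.
have s0' q : q \in s -> q != 0 by move=> qs; rewrite s0 // inE qs orbT.
apply: lcmp_dvdp; [exact/s0/mem_head | exact: lcm_seqp_neq0 | exact/sd/mem_head |].
by apply: IHs => // q qs; rewrite sd // inE qs orbT.
Qed.

(** At each stage the lcm divides the product of its two arguments and is a multiple of both, so it
    has exactly their roots. *)
Lemma root_lcm_seqp (F : numFieldType) (s : seq {poly rat}) (x : F) :
  (forall p, p \in s -> p != 0) ->
  root (map_poly ratr (lcm_seqp s)) x = has (fun p => root (map_poly ratr p) x) s.
Proof.
elim: s => [|p s IHs] s0 /=; first by rewrite rmorph1 (negbTE (root1 _)).
have p0 : p != 0 by rewrite s0 ?mem_head.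
have s0' q : q \in s -> q != 0 by move=> qs; rewrite s0 // inE qs orbT.
have l0 := lcm_seqp_neq0 s0'; set l := lcm_seqp s in l0 IHs *.
rewrite -IHs //; apply/idP/orP => [rl|].
  apply/orP; rewrite -rootM -rmorphM.
  rewrite -dvdp_XsubCl; rewrite -dvdp_XsubCl in rl; apply: dvdp_trans rl _.
  by rewrite dvdp_map -(eqp_dvdr _ (lcmp_mul_gcdp p0 l0)) dvdp_mulr.
by rewrite -!dvdp_XsubCl => -[] /dvdp_trans; apply; rewrite dvdp_map ?dvdp_lcmpl ?dvdp_lcmpr.
Qed.

Lemma qint_mul k : qint k * ('X - 1) = 'X^k - 1.
Proof. by rewrite /qint mulrC -subrX1. Qed.

Lemma qint_neq0 k : qint k.+1 != 0.
Proof.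
apply/eqP => q0; have := qint_mul k.+1; rewrite q0 mul0r => /esym/eqP.
by rewrite -size_poly_eq0 size_XnsubC.
Qed.

Lemma qint_dvdp k N : (k %| N)%N -> qint k %| 'X^N - 1.
Proof.
case/dvdnP => m ->; rewrite mulnC exprM.
apply: (@dvdp_trans _ ('X^k - 1)); first by rewrite -qint_mul dvdp_mulr.
by rewrite [X in _ %| X]subrX1 dvdp_mulr.
Qed.

Lemma root_qint (F : numFieldType) k (x : F) :
  root (map_poly ratr (qint k.+1)) x = (x != 1) && (x ^+ k.+1 == 1).
Proof.
have E : map_poly ratr (qint k.+1) = \sum_(i < k.+1) 'X^i :> {poly F}.
  by rewrite rmorph_sum /=; apply: eq_bigr => i _; rewrite map_polyXn.
rewrite E rootE horner_sum.
have -> : \sum_(i < k.+1) ('X^i).[x] = \sum_(i < k.+1) x ^+ i.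
  by apply: eq_bigr => i _; rewrite hornerXn.
have [->|x1] := eqVneq x 1 => /=.
  under eq_bigr do rewrite expr1n.
  by rewrite sumr_const card_ord pnatr_eq0.
by rewrite -[RHS]subr_eq0 subrX1 mulf_eq0 subr_eq0 (negbTE x1).
Qed.

(** The lcm divides ['X^N - 1], which over [algC] is a product of distinct linear factors, so its
    degree is its number of roots. For a primitive [N]-th root [z], the power [z ^+ i] is a root of
    [qint k.+1] exactly when it is not 1 and [N] divides [i * k.+1]. *)
Lemma XdegE n N (S : {set 'I_n}) : (0 < N)%N ->
  (forall k : nat, (0 < k <= n)%N -> (k %| N)%N) ->
  Xdeg S = #|[set i : 'I_N | (i != 0 :> nat) &&
                [exists k : 'I_n, (k \in S) && (N %| i * k.+1)%N]]|.
Proof.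
move=> N0 hN; rewrite /Xdeg; set s := map _ _.
have s0 p : p \in s -> p != 0 by case/mapP => i _ ->; apply: qint_neq0.
have sd p : p \in s -> p %| 'X^N - 1.
  by case/mapP => i _ ->; rewrite qint_dvdp // hN // ltn_ord.
have [z prim_z] := C_prim_root_exists N0.
have rL (i : 'I_N) : root (map_poly ratr (lcm_seqp s)) (z ^+ i) =
    (i != 0 :> nat) && [exists k : 'I_n, (k \in S) && (N %| i * k.+1)%N].
  have z1 : (z ^+ i == 1) = (i == 0 :> nat).
    by rewrite -(prim_order_dvd prim_z) /dvdn modn_small.
  rewrite root_lcm_seqp // has_map; apply/hasP/andP => [[k]|[i0]].
    rewrite mem_enum /= root_qint z1 -exprM -(prim_order_dvd prim_z).
    by move=> kS /andP[-> h]; split=> //; apply/existsP; exists k; rewrite kS.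
  case/existsP => k /andP[kS h]; exists k; rewrite ?mem_enum //= root_qint z1 i0.
  by rewrite -exprM -(prim_order_dvd prim_z).
have Ldvd : map_poly ratr (lcm_seqp s) %| \prod_(0 <= i < N) ('X - (z ^+ i)%:P).
  rewrite (factor_Xn_sub_1 prim_z).
  have -> : 'X^N - 1 = map_poly ratr ('X^N - 1) :> {poly algC}.
    by rewrite rmorphB /= map_polyXn rmorph1.
  by rewrite dvdp_map lcm_seqp_dvdp.
rewrite -(size_map_poly (ratr : {rmorphism rat -> algC})).
rewrite big_mkord in Ldvd.
have [m Lm] := dvdp_prod_XsubC Ldvd.
rewrite (eqp_size Lm) size_prod_XsubC /=.
have /card_uniqP <- : uniq (mask m (index_enum 'I_N)).
  by rewrite mask_uniq // index_enum_uniq.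
pose f (i : 'I_N) := z ^+ i.
have injf : injective f.
  move=> j k /eqP; rewrite (eq_prim_root_expr prim_z) !modn_small //.
  by move=> /eqP/val_inj.
apply: eq_card => i; rewrite inE -rL (eqp_root Lm).
by rewrite -(big_map f xpredT (fun x => 'X - x%:P)) root_prod_XsubC (mem_map injf).
Qed.

(** * Random subsets *)

Section BernoulliSets.
Variables (R : realType) (n : nat) (alpha : R).
Hypothesis alpha01 : 0 <= alpha <= 1.
Implicit Types (S D : {set 'I_n}) (g : {set 'I_n} -> R).
Local Notation beta := (1 - alpha).

Definition bweight S : R := alpha ^+ #|S| * beta ^+ (n - #|S|).

Definition bexp g : R := \sum_S bweight S * g S.

Let beta_ge0 : 0 <= beta. Proof. by case/andP: alpha01 => _; rewrite subr_ge0. Qed.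

Lemma bweight_ge0 S : 0 <= bweight S.
Proof. by case/andP: alpha01 => a0 _; rewrite mulr_ge0 // exprn_ge0. Qed.

(** The product form expresses the independence of the choices. *)
Lemma bweightE S : bweight S = \prod_i (if i \in S then alpha else beta).
Proof.
rewrite (bigID (mem S)) /=; congr (_ * _).
  by rewrite (eq_bigr (fun=> alpha)) ?prodr_const // => i ->.
rewrite (eq_bigl (mem (~: S))) => [|i]; last by rewrite /= finset.in_setC.
rewrite (eq_bigr (fun=> beta)) => [|i]; last by rewrite /= finset.in_setC => /negbTE ->.
by rewrite prodr_const -[X in (X - _)%N](card_ord n) -(cardsC S) addKn.
Qed.

Lemma bexp_disjoint D :
  bexp (fun S => [disjoint S & D]%:R) = beta ^+ #|D|.
Proof.
(* Expanding this product chooses a summand at each point; [S] collects the points where the first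
   one is chosen, and the zeros kill every [S] that meets [D]. *)
transitivity (\prod_(i : 'I_n) ((if i \in D then 0 else alpha) + beta)).
  rewrite bigA_distr /bexp big_mkcond /=; apply: eq_bigr => S _.
  rewrite bweightE; case: (boolP [disjoint S & D]) => [dSD|].
    rewrite mulr1; apply: eq_bigr => i _; case: ifP => // iS.
    by rewrite (disjointFr dSD).
  rewrite disjoint_sym; case/pred0Pn => i /andP[/= iD iS].
  by rewrite mulr0 (bigD1 i) //= iS iD mul0r.
rewrite (bigID (mem D)) /= [X in _ * X]big1 ?mulr1.
  rewrite (eq_bigr (fun=> beta)) ?prodr_const // => i ->.
  by rewrite add0r.
by move=> i /negbTE ->; rewrite addrC subrK.
Qed.

Lemma bexp1 : bexp (fun=> 1) = 1.
Proof.
rewrite -[RHS](expr0 beta) -(@cards0 'I_n) -bexp_disjoint.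
by apply: eq_bigr => S _; rewrite -finset.setI_eq0 finset.setI0 eqxx.
Qed.

Lemma bexpD g h : bexp (fun S => g S + h S) = bexp g + bexp h.
Proof. by rewrite -big_split; apply: eq_bigr => S _; rewrite mulrDr. Qed.

Lemma bexpZ c g : bexp (fun S => c * g S) = c * bexp g.
Proof. by rewrite mulr_sumr; apply: eq_bigr => S _; rewrite mulrCA. Qed.

Lemma bexp_sum (I : finType) (P : pred I) (g : I -> {set 'I_n} -> R) :
  bexp (fun S => \sum_(i | P i) g i S) = \sum_(i | P i) bexp (g i).
Proof.
by rewrite exchange_big; apply: eq_bigr => S _; rewrite mulr_sumr.
Qed.

Lemma eq_bexp g h : g =1 h -> bexp g = bexp h.
Proof. by move=> gh; apply: eq_bigr => S _; rewrite gh. Qed.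

Lemma chebyshev_bprob g m t : 0 < t ->
  bprob alpha (fun S => t < `|g S - m|) <= bexp (fun S => (g S - m) ^+ 2) / t ^+ 2.
Proof.
move=> t0; rewrite ler_pdivlMr ?exprn_gt0 // mulr_suml big_mkcond.
apply: ler_sum => S _; case: ifP => [tS|_].
  rewrite ler_wpM2l ?bweight_ge0 // -[leRHS]real_normK ?num_real //.
  by rewrite ler_sqr ?nnegrE ?normr_ge0 ?ltW // (lt_trans t0).
by rewrite mulr_ge0 ?bweight_ge0 ?sqr_ge0.
Qed.

(** Bernoulli's inequality; in probabilistic terms, the union bound for meeting a set of [k]
    points. *)
Lemma one_sub_beta_expr_le k : 1 - beta ^+ k <= alpha * k%:R.
Proof.
case/andP: alpha01 => a0 a1; elim: k => [|k IHk]; first by rewrite expr0 mulr0 subrr.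
have b1 : beta ^+ k <= 1 by apply: exprn_ile1 => //; lra.
by rewrite exprS -natr1; nra.
Qed.

(** Missing both sets means missing their union, so the left side is [beta ^+ #|D :|: E| * (1 - beta
    ^+ #|D :&: E|)], whose first factor is at most 1. *)
Lemma cov_hit_le D (E : {set 'I_n}) :
  bexp (fun S => [disjoint S & D]%:R * [disjoint S & E]%:R)
    - beta ^+ #|D| * beta ^+ #|E| <= alpha * #|D :&: E|%:R.
Proof.
rewrite (@eq_bexp _ (fun S => [disjoint S & D :|: E]%:R)); last first.
  move=> S; rewrite -natrM mulnb; congr (_%:R); congr nat_of_bool.
  by rewrite -!finset.setI_eq0 finset.setIUr finset.setU_eq0.
rewrite bexp_disjoint -exprD -cardsUI exprD.
have b0 := beta_ge0; have b1 : beta <= 1 by case/andP: alpha01 => *; lra.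
apply: le_trans (one_sub_beta_expr_le _).
have := exprn_ile1 #|D :|: E| b0 b1; have := exprn_ge0 #|D :|: E| b0.
have := exprn_ile1 #|D :&: E| b0 b1; have := exprn_ge0 #|D :&: E| b0.
by move=> *; nra.
Qed.

(** The variance expands into covariances. The double sum of [#|D i :&: D j|], regrouped by the
    common point [k], is a sum of squared multiplicities. *)
Lemma var_hit_le (I : finType) (P : pred I) (D : I -> {set 'I_n}) :
  bexp (fun S => (\sum_(i | P i) (~~ [disjoint S & D i])%:R
                    - \sum_(i | P i) (1 - beta ^+ #|D i|)) ^+ 2)
  <= alpha * \sum_(k < n) (\sum_(i | P i) (k \in D i)%:R) ^+ 2.
Proof.
(* The centred indicator of [S] meeting [D i], written through the event of missing [D i]. *)
pose Y i S : R := beta ^+ #|D i| - [disjoint S & D i]%:R.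
rewrite (@eq_bexp _ (fun S => \sum_(i | P i) \sum_(j | P j) Y i S * Y j S)).
  rewrite bexp_sum.
  under eq_bigr do rewrite bexp_sum.
  have -> : alpha * (\sum_(k < n) (\sum_(i | P i) (k \in D i)%:R) ^+ 2) =
     \sum_(i | P i) \sum_(j | P j) alpha * #|D i :&: D j|%:R.
    rewrite [RHS]exchange_big /=.
    under [RHS]eq_bigr do rewrite -mulr_sumr.
    rewrite -mulr_sumr; congr (_ * _).
    under eq_bigr do rewrite expr2 mulr_suml.
    rewrite exchange_big /= [RHS]exchange_big /=; apply: eq_bigr => i Pi.
    under eq_bigr do rewrite mulr_sumr.
    rewrite exchange_big /=; apply: eq_bigr => j Pj.
    rewrite -sum1_card natr_sum [RHS]big_mkcond /=; apply: eq_bigr => k _.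
    by rewrite inE -natrM mulnb; case: (_ && _).
  apply: ler_sum => i _; apply: ler_sum => j _.
  apply: le_trans (cov_hit_le _ _).
  rewrite (@eq_bexp _ (fun S => [disjoint S & D i]%:R * [disjoint S & D j]%:R
    + (- (beta ^+ #|D i|) * [disjoint S & D j]%:R +
      (- (beta ^+ #|D j|) * [disjoint S & D i]%:R +
         (beta ^+ #|D i| * beta ^+ #|D j|) * 1)))); last by move=> S; rewrite /Y; ring.
  by rewrite !bexpD !bexpZ bexp1 !bexp_disjoint; lra.
move=> S; rewrite -sumrB; under eq_bigr => i _.
  have -> : (~~ [disjoint S & D i])%:R - (1 - beta ^+ #|D i|) = Y i S.
    by rewrite /Y; case: [disjoint _ & _] => /=; ring.
  over.
by rewrite expr2 mulr_suml; apply: eq_bigr => i _; rewrite mulr_sumr.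
Qed.

End BernoulliSets.

(** * The dilogarithm and zeta(2) *)

Section Basel.
Variable R : realType.
Implicit Types x b : R.

Lemma sin_le_id x : 0 <= x -> sin x <= x.
Proof.
move=> x0; pose f := fun y : R => y - sin y.
have df (y : R) : is_derive y 1 f (1 - cos y).
  by rewrite /f; apply: is_derive_eq.
have [|c _] := @MVT_segment R f (fun y => 1 - cos y) 0 x x0.
  apply: continuous_subspaceT => y; apply: differentiable_continuous.
  by apply/derivable1_diffP; exact: (@ex_derive _ _ _ _ _ _ _ (df y)).
rewrite /f sin0 !subr0 => E; rewrite -subr_ge0 E mulr_ge0 // subr_ge0 cos_le1.
Qed.

Lemma mul_cos_le_sin x : 0 <= x <= pi -> x * cos x <= sin x.
Proof.
move=> /andP[x0 x1].
pose f := fun y : R => sin y - y * cos y.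
have df (y : R) : is_derive y 1 f (y * sin y).
  rewrite /f; apply: is_derive_eq.
  by rewrite /GRing.scale/=; ring.
have [|c /[!in_itv]/= /andP[c0 cx]] := @MVT_segment R f (fun y => y * sin y) 0 x x0.
  apply: continuous_subspaceT => y; apply: differentiable_continuous.
  by apply/derivable1_diffP; exact: (@ex_derive _ _ _ _ _ _ _ (df y)).
rewrite /f sin0 mul0r !subr0 => E; rewrite -subr_ge0 E mulr_ge0 // mulr_ge0 //.
by apply: sin_ge0_pi; rewrite c0 (le_trans cx).
Qed.

Lemma invsin2_double x : sin x != 0 -> cos x != 0 ->
  (sin x) ^- 2 + (cos x) ^- 2 = 4 * (sin (x *+ 2)) ^- 2.
Proof.
move=> s0 c0; rewrite sin_mulr2n.
have -> : sin x ^- 2 + cos x ^- 2 = (cos x ^+ 2 + sin x ^+ 2) / (sin x ^+ 2 * cos x ^+ 2).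
  by field; rewrite s0 c0.
by rewrite cos2Dsin2; field; rewrite ?s0 ?c0 ?mulf_neq0.
Qed.

(** For [k < 2 ^ n] these are the odd multiples of [pi / 2 ^+ n.+2] strictly between 0 and
    [pi / 2]. *)
Definition odd_angle n k : R := (k.*2.+1)%:R * pi / 2 ^+ n.+2.

Let theta_pi2 n k : (k < 2 ^ n)%N -> 0 < odd_angle n k < pi / 2.
Proof.
move=> kn; have p0 := pi_gt0 R; rewrite /odd_angle; apply/andP; split.
  by apply: divr_gt0; [apply: mulr_gt0; rewrite ?ltr0n | apply: exprn_gt0; rewrite ltr0n].
rewrite ltr_pdivrMr ?exprn_gt0 // mulrC.
have -> : pi / 2 * 2 ^+ n.+2 = pi * (2 ^ n.+1)%:R :> R by rewrite natrX !exprS; field.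
by rewrite ltr_pM2l // ltr_nat expnS; lia.
Qed.

Let sin_theta n k : (k < 2 ^ n)%N -> 0 < sin (odd_angle n k).
Proof. by move=> /theta_pi2/sin_gt0_pihalf. Qed.

Let cos_theta n k : (k < 2 ^ n)%N -> 0 < cos (odd_angle n k).
Proof.
move=> /theta_pi2/andP[h1 h2]; apply: cos_gt0_pihalf.
by rewrite h2 (lt_trans _ h1) // oppr_lt0 divr_gt0 ?pi_gt0.
Qed.

Let thetaS n k : odd_angle n.+1 k *+ 2 = odd_angle n k.
Proof. by rewrite /odd_angle !exprS; field; rewrite expf_neq0. Qed.

Let theta_compl n k : (k < 2 ^ n.+1)%N ->
   odd_angle n.+1 (2 ^ n.+1 - k.+1) = pi / 2 - odd_angle n.+1 k.
Proof.
move=> kn; rewrite /odd_angle.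
have -> : (2 ^ n.+1 - k.+1).*2.+1%:R = 2 ^+ n.+2 - k.*2.+1%:R :> R.
  apply/eqP; rewrite eq_sym subr_eq -natrX -natrD eqr_nat; apply/eqP.
  by rewrite [in LHS]expnS; lia.
by rewrite !exprS; field; rewrite expf_neq0.
Qed.

(* Hofbauer's induction: [x |-> pi / 2 - x] pairs the angles of level [n.+1], and
   each pair contributes [4] times the term of the doubled angle, of level [n]. *)
Lemma sum_invsin2 n :
  \sum_(0 <= k < 2 ^ n) (sin (odd_angle n k)) ^- 2 = 2 * 4 ^+ n.
Proof.
elim: n => [|n IHn].
  rewrite expn0 big_nat1 /odd_angle.
  have -> : 0.*2.+1%:R * pi / 2 ^+ 2 = pi / 4 :> R by rewrite double0; field.
  have [p0 h1 h2] : [/\ 0 < pi :> R, 0 < pi / 4 :> R & pi / 4 < pi / 2 :> R].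
    by have := pi_gt0 R; split; lra.
  have h : (0 < (pi : R) / 4) && ((pi : R) / 4 < pi / 2) by rewrite h1 h2.
  have s0 : sin (pi / 4) != 0 :> R by rewrite gt_eqF // sin_gt0_pihalf.
  have c0 : cos (pi / 4) != 0 :> R.
    by rewrite gt_eqF // cos_gt0_pihalf //; apply/andP; split; lra.
  have := invsin2_double s0 c0.
  have -> : (pi / 4) *+ 2 = pi / 2 :> R by lra.
  have -> : cos (pi / 4) = sin (pi / 4) :> R.
    have e : pi / 4 = - (pi / 4) + pi / 2 :> R by lra.
    by rewrite [in LHS]e cosDpihalf sinN opprK.
  by rewrite sin_pihalf expr1n invr1; lra.
rewrite (big_cat_nat _ (n := 2 ^ n)) /=; [|by []|by rewrite leq_exp2l].
have -> : \sum_(2 ^ n <= k < 2 ^ n.+1) (sin (odd_angle n.+1 k)) ^- 2 =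
    \sum_(0 <= k < 2 ^ n) (cos (odd_angle n.+1 k)) ^- 2.
  rewrite big_rev_mkord big_mkord.
  have -> : (2 ^ n.+1 - 2 ^ n = 2 ^ n)%N by rewrite expnS; lia.
  apply: eq_bigr => k _; have := ltn_ord k => kn.
  by rewrite theta_compl ?sinB ?sin_pihalf ?cos_pihalf ?mul1r ?mul0r ?subr0 // expnS; lia.
rewrite -big_split /= exprS mulrCA -IHn mulr_sumr.
apply: eq_big_nat => k /= kn.
have kn1 : (k < 2 ^ n.+1)%N by rewrite expnS; lia.
by rewrite invsin2_double ?thetaS // gt_eqF // ?sin_theta ?cos_theta.
Qed.

(* Termwise from [cot^2 x <= x^-2 <= sin^-2 x]. *)
Lemma sum_odd_sqr_bounds n :
  pi ^+ 2 / 8 - pi ^+ 2 / 16 / 2 ^+ n <=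
    \sum_(0 <= k < 2 ^ n) ((k.*2.+1)%:R ^- 2 : R) <= pi ^+ 2 / 8.
Proof.
have p0 := pi_gt0 R; have N0 : 2 ^+ n != 0 :> R by rewrite expf_neq0.
have E4 : 4 ^+ n = 2 ^+ n * 2 ^+ n :> R by rewrite -exprMn; congr (_ ^+ _); lra.
have -> : \sum_(0 <= k < 2 ^ n) ((k.*2.+1)%:R ^- 2 : R) =
    pi ^+ 2 / 16 / 4 ^+ n * \sum_(0 <= k < 2 ^ n) (odd_angle n k) ^- 2.
  rewrite mulr_sumr; apply: eq_bigr => k _; rewrite /odd_angle !exprS E4 expr0 mulr1.
  have k0 : k.*2.+1%:R != 0 :> R by rewrite pnatr_eq0.
  move: (k.*2.+1%:R) (pi : R) k0 (lt0r_neq0 p0) => K P K0 P0.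
  by field; rewrite N0 K0 P0.
have lek k : (k < 2 ^ n)%N -> sin (odd_angle n k) ^- 2 - 1 <= odd_angle n k ^- 2 <= sin (odd_angle n k) ^- 2.
  move=> kn; have s0 := sin_theta kn; have c0 := cos_theta kn.
  have /andP[t0 t1] := theta_pi2 kn.
  have st := sin_le_id (ltW t0).
  have ct : odd_angle n k * cos (odd_angle n k) <= sin (odd_angle n k).
    by apply: mul_cos_le_sin; rewrite ltW //=; lra.
  have s20 : 0 < sin (odd_angle n k) ^+ 2 by rewrite exprn_gt0.
  have t20 : 0 < odd_angle n k ^+ 2 by rewrite exprn_gt0.
  apply/andP; split; last by rewrite lef_pV2 ?posrE // ler_sqr ?nnegrE ?(ltW s0) ?(ltW t0).
  have -> : sin (odd_angle n k) ^- 2 - 1 = cos (odd_angle n k) ^+ 2 / sin (odd_angle n k) ^+ 2.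
    by rewrite cos2sin2; field; rewrite gt_eqF.
  rewrite ler_pdivrMr // mulrC ler_pdivlMr // -exprMn mulrC.
  by rewrite ler_sqr ?nnegrE // ?(ltW s0) // mulr_ge0 ?(ltW t0) ?(ltW c0).
(* Losing 1 in each of the [2 ^ n] terms is what costs [pi ^+ 2 / 16 / 2 ^+ n] after rescaling. *)
have [lo hi] : 2 * 4 ^+ n - 2 ^+ n <= \sum_(0 <= k < 2 ^ n) (odd_angle n k) ^- 2 /\
     \sum_(0 <= k < 2 ^ n) (odd_angle n k) ^- 2 <= 2 * 4 ^+ n.
  rewrite -sum_invsin2; split; last first.
    by apply: ler_sum_nat => k /= /lek/andP[].
  have -> : 2 ^+ n = \sum_(0 <= k < 2 ^ n) 1 :> R.
    by rewrite sumr_const_nat subn0 natrX.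
  by rewrite -sumrB; apply: ler_sum_nat => k /= /lek/andP[].
have c0 : 0 <= pi ^+ 2 / 16 / 4 ^+ n :> R by rewrite !divr_ge0 ?exprn_ge0 ?ltW.
have := ler_wpM2l c0 hi; have := ler_wpM2l c0 lo.
have -> : pi ^+ 2 / 16 / 4 ^+ n * (2 * 4 ^+ n - 2 ^+ n) = pi ^+ 2 / 8 - pi ^+ 2 / 16 / 2 ^+ n :> R.
  by rewrite E4; field.
have -> : pi ^+ 2 / 16 / 4 ^+ n * (2 * 4 ^+ n) = pi ^+ 2 / 8 :> R.
  by rewrite E4; field.
by move=> -> ->.
Qed.

(** The tail telescopes: for [k > 0] the term of index [k] is at most [b / k - b / (k + 1)]. *)
Lemma Li2_bounds b n : 0 <= b <= 1 ->
  \sum_(0 <= k < n.+1) b ^+ k.+1 / (k.+1)%:R ^+ 2 <= Li2 b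
  <= \sum_(0 <= k < n.+1) b ^+ k.+1 / (k.+1)%:R ^+ 2 + b / n.+1%:R.
Proof.
move=> /andP[b0 b1]; set f := fun k : nat => b ^+ k.+1 / (k.+1)%:R ^+ 2.
have f0 k : 0 <= f k by rewrite divr_ge0 ?exprn_ge0.
have nd : nondecreasing_seq (series f).
  by apply/nondecreasing_seqP => k; rewrite /series/= big_nat_recr //= lerDl.
have ub m : series f m <= series f n.+1 + b / n.+1%:R.
  have [mn|nm] := leqP m n.+1.
    by rewrite (le_trans (nd _ _ mn)) // lerDl divr_ge0.
  (* Keeping the telescoped remainder [b / m] makes the bound inductive. *)
  suff : series f m <= series f n.+1 + b / n.+1%:R - b / m%:R.
    by move=> /le_trans; apply; rewrite gerBl divr_ge0.
  elim: m nm => [//|m IHm nm]; rewrite ltnS leq_eqVlt in nm.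
  have m0 : 0 < m%:R :> R by rewrite ltr0n; case/predU1P: nm => [<-//|]; apply: leq_trans.
  have fm : f m <= b / m%:R - b / m.+1%:R.
    have -> : b / m%:R - b / m.+1%:R = b / (m%:R * m.+1%:R).
      by rewrite -natr1; field; rewrite ?gt_eqF // natr1 pnatr_eq0.
    apply: ler_pM; rewrite ?exprn_ge0 ?invr_ge0 ?exprn_ge0 //.
      by rewrite exprS ler_piMr // exprn_ile1.
    rewrite lef_pV2 ?posrE ?mulr_gt0 ?exprn_gt0 // expr2 ler_pM2r //.
    by rewrite ler_nat.
  have -> : series f m.+1 = series f m + f m by rewrite /series/= big_nat_recr.
  case/predU1P: nm fm => [<-|/IHm ih] fm; first by rewrite -addrA lerD2l.
  by apply: le_trans (lerD ih fm) _; rewrite addrA subrK.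
have cv : cvgn (series f).
  apply: nondecreasing_is_cvgn => //.
  by exists (series f n.+1 + b / n.+1%:R) => _ [m _ <-].
apply/andP; split; first exact: nondecreasing_cvgn_le.
by apply: limr_le => //; apply: nearW.
Qed.

(** Splitting the series by parity gives [z = pi ^+ 2 / 8 + z / 4]. In finite form the defect [d] is
    at most [4 / N] for every [N = 2 ^ n.+1], hence zero by the Archimedean property. *)
Lemma Li2_1 : Li2 1 = pi ^+ 2 / 6 :> R.
Proof.
set z := Li2 1; pose s n : R := \sum_(0 <= k < n) k.+1%:R ^- 2.
have hz n : (0 < n)%N -> s n <= z <= s n + n%:R^-1.
  case: n => // n _; have := @Li2_bounds 1 n; rewrite ler01 lexx div1r => /(_ isT).
  rewrite -/z; have -> // : \sum_(0 <= k < n.+1) 1 ^+ k.+1 / k.+1%:R ^+ 2 = s n.+1.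
  by apply: eq_bigr => k _; rewrite expr1n div1r.
have s2 n : s n.*2 = \sum_(0 <= k < n) (k.*2.+1)%:R ^- 2 + s n / 4.
  rewrite /s; elim: n => [|n IHn]; first by rewrite double0 !big_geq //; lra.
  rewrite doubleS !big_nat_recr //= IHn.
  have -> : n.*2.+2%:R ^- 2 = n.+1%:R ^- 2 / 4 :> R.
    have -> : n.*2.+2%:R = 2 * n.+1%:R :> R by rewrite -natrM; congr (_%:R); lia.
    have : n.+1%:R != 0 :> R by rewrite pnatr_eq0.
    by move: (n.+1%:R) => K K0; field.
  by rewrite mulrDl; ring.
pose d : R := `|3 / 4 * z - pi ^+ 2 / 8|.
have hd n : d * n%:R <= 4.
  case: n => [|n]; first by rewrite mulr0.
  set N := (2 ^ n.+1)%N.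
  have N0 : (0 < N)%N by rewrite expn_gt0.
  have nN : (n.+1 <= N)%N by apply/ltnW/ltn_expl.
  have := sum_odd_sqr_bounds n.+1.
  have := hz N N0; have := hz N.*2 _; rewrite double_gt0 => /(_ N0).
  rewrite s2 -/N -natrX -/N.
  have p0 := pi_ge0 R; have p4 : pi <= 4 :> R by have := pihalf_lt2 R; lra.
  have N0' : 0 < N%:R :> R by rewrite ltr0n.
  have hp : pi ^+ 2 / 16 / N%:R <= N%:R^-1 :> R.
    rewrite ler_piMl ?invr_ge0 ?(ltW N0') //.
    by move: (pi : R) p0 p4 => P *; nra.
  have hN2 : N.*2%:R^-1 <= N%:R^-1 :> R.
    by rewrite lef_pV2 ?posrE ?ltr0n ?double_gt0 // ler_nat -addnn leq_addr.
  have iN : 0 < N%:R^-1 :> R by rewrite invr_gt0.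
  move=> /andP[h1 h2] /andP[h3 h4] /andP[h5 h6].
  have dN : d <= 4 * N%:R^-1 by rewrite ler_norml; apply/andP; split; lra.
  apply: le_trans (_ : d * N%:R <= _); first by rewrite ler_wpM2l ?normr_ge0 // ler_nat.
  by rewrite -ler_pdivlMr.
have d0 : d = 0.
  apply/eqP; rewrite eq_le normr_ge0 andbT leNgt; apply/negP => d0.
  have := archi_boundP (divr_ge0 (ler0n R 4) (ltW d0)).
  by rewrite ltr_pdivrMr // mulrC ltNge hd.
move/eqP: d0; rewrite normr_eq0 subr_eq0 => /eqP; lra.
Qed.

End Basel.

(** * Counting reduced fractions *)

Section Denominators.
Local Open Scope nat_scope.

(** The denominator of [i / N] in lowest terms; equally, the order of the [i]-th power of a
    primitive [N]-th root of unity. *)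
Definition denom (N i : nat) : nat := N %/ gcdn N i.

Lemma denom_gt0 N i : 0 < N -> 0 < denom N i.
Proof. by move=> N0; rewrite divn_gt0 ?gcdn_gt0 ?N0 // dvdn_leq ?dvdn_gcdl. Qed.

Lemma denom_dvd N i k : 0 < N -> (denom N i %| k) = (N %| i * k).
Proof.
move=> N0; have g0 : 0 < gcdn N i by rewrite gcdn_gt0 N0.
rewrite /denom -(dvdn_pmul2r g0) divnK ?dvdn_gcdl //.
by rewrite muln_gcdr dvdn_gcd dvdn_mull //= mulnC.
Qed.

Lemma sum_dvdn_lt N e : e %| N -> \sum_(0 <= i < N) (e %| i) = N %/ e.
Proof.
(* [divn_count_dvd] counts the multiples from 1 to [N]. Adding 1 to both sides trades the endpoint
   [N] for 0, both being multiples of [e]. *)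
move=> eN; rewrite divn_count_dvd; apply: (@addIn 1).
rewrite -[X in _ + X = _](congr1 nat_of_bool eN) -[LHS]big_nat_recr //= big_nat_recl //.
by rewrite dvdn0 addnC big_add1.
Qed.

Lemma sum_mul_dvdn N k : 0 < N -> k %| N -> \sum_(0 <= i < N) (N %| i * k) = k.
Proof.
move=> N0 kN; have k0 : 0 < k by apply: dvdn_gt0 kN.
rewrite (eq_bigr (fun i => (N %/ k %| i) : nat)) => [|i _].
  by rewrite sum_dvdn_lt ?divnA ?mulKn // dvdn_div.
by rewrite -[in LHS](divnK kN) dvdn_pmul2r.
Qed.

(* The number of [a / N] in [0, 1) whose reduced denominator is at most [m]; when all
   positive integers up to [m] divide [N], this is the sum of [totient d], [1 <= d <= m]. *)
Definition count_denom N m := \sum_(0 <= i < N) (denom N i <= m).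

Lemma sum_leq_nat m a : a <= m -> \sum_(1 <= j < m.+1) (j <= a) = a.
Proof.
move=> am; rewrite (big_cat_nat _ (n := a.+1)) //= [X in _ + X]big_nat_cond.
rewrite [X in _ + X]big1 ?addn0 => [|j /andP[/andP[aj _] _]]; last by rewrite leqNgt aj.
rewrite big_nat_cond (eq_bigr (fun=> 1)) => [|j /andP[/andP[_ ja] _]]; last by rewrite -ltnS ja.
by rewrite -big_nat_cond sum_nat_const_nat subn1 muln1.
Qed.

(** For fixed [i], the [j] with [denom N i <= m %/ j] are as many as the multiples [k <= m] of
    [denom N i], that is, the [k] with [N %| i * k]. Conversely, each such [k] serves exactly [k]
    indices [i < N]. *)
Lemma count_denom_sum n N m : 0 < N -> (forall k, 0 < k <= n -> k %| N) -> m <= n ->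
  \sum_(1 <= j < m.+1) count_denom N (m %/ j) = \sum_(1 <= k < m.+1) k.
Proof.
move=> N0 hN mn; rewrite exchange_big_nat /=.
have step i : \sum_(1 <= j < m.+1) (denom N i <= m %/ j) = \sum_(1 <= k < m.+1) (N %| i * k).
  rewrite -[RHS](eq_bigr _ (fun k _ => congr1 nat_of_bool (denom_dvd i k N0))).
  rewrite -divn_count_dvd -[RHS](@sum_leq_nat m) ?leq_div //.
  apply: eq_big_nat => j /andP[j0 _].
  by rewrite leq_divRL // [in RHS]leq_divRL ?denom_gt0 // mulnC.
rewrite (eq_bigr _ (fun i _ => step i)) exchange_big_nat /=.
apply: eq_big_nat => k /andP[k0 km]; apply: sum_mul_dvdn => //.
by rewrite hN // k0 (leq_trans _ mn).
Qed.

End Denominators.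

(** * Quadratic growth from the summation identity *)

Section QuadraticGrowth.
Variable R : realType.
Local Notation c := (3 / pi ^+ 2 : R).

Lemma sum_invsqr_bounds n : (0 < n)%N ->
  \sum_(1 <= j < n.+1) (j%:R ^- 2) <= (pi ^+ 2 / 6 : R)
    <= \sum_(1 <= j < n.+1) (j%:R ^- 2) + n%:R^-1.
Proof.
case: n => // n _; have := @Li2_bounds R 1 n; rewrite ler01 lexx div1r Li2_1 => /(_ isT).
have -> // : \sum_(0 <= k < n.+1) 1 ^+ k.+1 / k.+1%:R ^+ 2
    = \sum_(1 <= j < n.+2) j%:R ^- 2 :> R.
by rewrite big_add1; apply: eq_bigr => k _; rewrite expr1n div1r.
Qed.

(** The term [1 / 4], then a telescoping tail of at most [1 / 2]. A bound below 1 is what makes the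
    recursion a contraction. *)
Lemma sum_invsqr_from2_le n : \sum_(2 <= j < n.+1) (j%:R ^- 2) <= 3 / 4 :> R.
Proof.
have [n2|n2] := leqP n 1; first by rewrite big_geq //; lra.
suff : \sum_(2 <= j < n.+1) (j%:R ^- 2) <= 3 / 4 - n%:R^-1 :> R.
  by move=> /le_trans; apply; rewrite gerBl invr_ge0.
elim: n n2 => [//|n IHn]; rewrite ltnS leq_eqVlt => /predU1P[<-|n2].
  by rewrite big_nat1; lra.
rewrite big_nat_recr //=; last exact: leqW.
have n0 : 0 < n%:R :> R by rewrite ltr0n (leq_trans _ n2).
apply: le_trans (lerD (IHn n2) (_ : _ <= n%:R^-1 - n.+1%:R^-1)) _; last by rewrite addrA subrK.
have -> : n%:R^-1 - n.+1%:R^-1 = (n%:R * n.+1%:R)^-1 :> R.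
  have : n%:R + 1 != 0 :> R by rewrite natr1 pnatr_eq0.
  by rewrite -natr1; move: (n%:R) n0 => x x0 x1; field; rewrite x1 gt_eqF.
rewrite lef_pV2 ?posrE ?mulr_gt0 ?exprn_gt0 // expr2 ler_pM2r //.
by rewrite ler_nat.
Qed.

Lemma fraction_density_bounds : 0 < c <= 3 / 4.
Proof.
have p2 := pi_ge2 R; have p0 := pi_gt0 R.
have p4 : 4 <= pi ^+ 2 :> R by move: (pi : R) p2 => P *; nra.
rewrite divr_gt0 ?exprn_gt0 //= ler_pM2l // lef_pV2 ?posrE ?exprn_gt0 //.
Qed.

(** With zeta(2) equal to [pi ^+ 2 / 6], this balances the main terms of the recursion: [c * m ^ 2]
    summed over all [m / j] gives [m ^ 2 / 2]. *)
Lemma fraction_density_zeta2 : c * (pi ^+ 2 / 6) = 2^-1.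
Proof.
have := lt0r_neq0 (pi_gt0 R); move: (pi : R) => P P0; by field.
Qed.

(** The range stops at [n] because [count_denom N] satisfies the recursion only as far as all
    [k <= m] divide [N]; the constants found below are uniform in [Phi] and [n]. *)
Definition quad_approx (Phi : nat -> nat) (n : nat) (eta C : R) :=
  forall m, (0 < m <= n)%N -> `|(Phi m)%:R - c * m%:R ^+ 2| <= eta * m%:R ^+ 2 + C.

(** With [x = m / j] and [q] its floor, [x ^ 2 - q ^ 2 <= 2 * x], and the arithmetic-geometric mean
    inequality turns [2 * x] into [kappa * x ^ 2 + 1 / kappa]. *)
Lemma quad_approx_div Phi n eta C kappa m j : 0 <= eta -> 0 < kappa ->
  quad_approx Phi n eta C -> (0 < j <= m)%N -> (m <= n)%N ->
  `|(Phi (m %/ j)%N)%:R - c * (m%:R / j%:R) ^+ 2|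
     <= (eta + kappa) * (m%:R / j%:R) ^+ 2 + (C + kappa^-1).
Proof.
move=> eta0 k0 HPhi /andP[j0 jm] mn.
have q0 : (0 < m %/ j)%N by rewrite divn_gt0.
have := HPhi (m %/ j)%N; rewrite q0 (leq_trans (leq_div _ _) mn) => /(_ isT).
have jr : 0 < j%:R :> R by rewrite ltr0n.
have h1 : (m %/ j)%:R <= m%:R / j%:R :> R.
  by rewrite ler_pdivlMr // -natrM ler_nat leq_trunc_div.
have h2 : m%:R / j%:R <= (m %/ j)%:R + 1 :> R.
  by rewrite ler_pdivrMr // natr1 -natrM ler_nat ltnW // ltn_ceil.
have q1 : 0 <= (m %/ j)%:R :> R by [].
have /andP[c0 c1] := fraction_density_bounds.
move: (m%:R / j%:R) ((m %/ j)%:R) (Phi _) q1 h1 h2 => x q p q1 h1 h2.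
rewrite !ler_norml => /andP[h3 h4].
have hk : 2 * x <= kappa * x ^+ 2 + kappa^-1.
  rewrite -subr_ge0; have -> : kappa * x ^+ 2 + kappa^-1 - 2 * x = kappa * (x - kappa^-1) ^+ 2.
    by field; rewrite gt_eqF.
  by rewrite mulr_ge0 ?sqr_ge0 // ltW.
have hqx : q ^+ 2 <= x ^+ 2 by nra.
have hxq : x ^+ 2 - q ^+ 2 <= 2 * x by nra.
have hc : c * (x ^+ 2 - q ^+ 2) <= 2 * x.
  move: (3 / pi ^+ 2 : R) c0 c1 => cc c0 c1; nra.
have hc0 : 0 <= c * (x ^+ 2 - q ^+ 2) by rewrite mulr_ge0 ?subr_ge0 // ltW.
have he : eta * q ^+ 2 <= eta * x ^+ 2 by rewrite ler_wpM2l.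
move: (3 / pi ^+ 2 : R) h3 h4 hc hc0 => cc h3 h4 hc hc0.
apply/andP; split; lra.
Qed.

(** Isolate the term [j = 1] of the recursion and apply the current bound to all [j >= 2], where the
    weights [1 / j ^ 2] sum to at most [3 / 4]. *)
Lemma quad_approx_step eta C : 0 < eta -> 0 <= C -> exists C', 0 <= C' /\
  forall (Phi : nat -> nat) n,
   (forall m, (m <= n)%N -> \sum_(1 <= j < m.+1) Phi (m %/ j) = \sum_(1 <= k < m.+1) k)%N ->
   quad_approx Phi n eta C -> quad_approx Phi n (7 / 8 * eta) C'.
Proof.
(* With [kappa = eta / 16] the quadratic errors total [3/4 * 17/16 + 1/16 = 55/64] of [eta], below
   [7/8]. In [B], the 2 covers [m / 2] from the triangular number and at most [m] from truncating
   zeta(2); the rest is the constant error of each term. *)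
move=> eta0 C0; pose kappa := eta / 16; have k0 : 0 < kappa by rewrite divr_gt0.
pose B := 2 + (C + kappa^-1); exists (B ^+ 2 / kappa); split.
  by rewrite divr_ge0 ?sqr_ge0 // ltW.
move=> Phi n rec HPhi m /andP[m0 mn].
have mr : 0 < m%:R :> R by rewrite ltr0n.
have gauss : \sum_(1 <= k < m.+1) k%:R = (m%:R ^+ 2 + m%:R) / 2 :> R.
  elim: {rec HPhi mn m0 mr} m => [|m IHm]; first by rewrite big_geq //; ring.
  by rewrite big_nat_recr //= IHm -natr1; field.
have e1 : (Phi m)%:R + \sum_(2 <= j < m.+1) (Phi (m %/ j)%N)%:R = (m%:R ^+ 2 + m%:R) / 2 :> R.
  have e0 := rec m mn; rewrite big_ltn // divn1 in e0.
  by rewrite -gauss -!natr_sum -natrD e0.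
have e2 := sum_invsqr_bounds m0; rewrite big_ltn // expr1n invr1 in e2.
set s := \sum_(2 <= j < m.+1) (j%:R ^- 2) in e2.
have s34 : s <= 3 / 4 := sum_invsqr_from2_le m.
have e3 : `|\sum_(2 <= j < m.+1) ((Phi (m %/ j)%N)%:R - c * (m%:R / j%:R) ^+ 2)|
   <= (eta + kappa) * m%:R ^+ 2 * s + m%:R * (C + kappa^-1).
  apply: le_trans (ler_norm_sum _ _ _) _.
  apply: le_trans (_ : _ <= \sum_(2 <= j < m.+1) ((eta + kappa) * (m%:R / j%:R) ^+ 2 + (C + kappa^-1))) _.
    apply: ler_sum_nat => j /andP[j2 jm]; apply: (quad_approx_div (ltW eta0) k0 HPhi) => //.
    by rewrite (leq_trans _ j2).
  rewrite big_split /= sumr_const_nat mulr_sumr; apply: lerD.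
    rewrite le_eqVlt; apply/orP; left; apply/eqP; apply: eq_bigr => j _.
    by rewrite exprMn exprVn mulrA.
  rewrite -[X in X <= _]mulr_natl ler_wpM2r //; last by rewrite ler_nat; lia.
  by rewrite addr_ge0 // invr_ge0 ltW.
have e4 : \sum_(2 <= j < m.+1) ((Phi (m %/ j)%N)%:R - c * (m%:R / j%:R) ^+ 2) =
  \sum_(2 <= j < m.+1) (Phi (m %/ j)%N)%:R - c * m%:R ^+ 2 * s.
  rewrite sumrB; congr (_ - _); rewrite mulr_sumr; apply: eq_bigr => j _.
  by rewrite exprMn exprVn mulrA.
rewrite {}e4 in e3.
have hB : B * m%:R <= kappa * m%:R ^+ 2 + B ^+ 2 / kappa.
  rewrite -subr_ge0.
  have -> : kappa * m%:R ^+ 2 + B ^+ 2 / kappa - B * m%:R =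
     kappa * (m%:R - B / kappa / 2) ^+ 2 + 3 / 4 * (B ^+ 2 / kappa).
    by field; rewrite gt_eqF.
  apply: addr_ge0; first by rewrite mulr_ge0 ?sqr_ge0 // ltW.
  by apply: mulr_ge0; rewrite ?divr_ge0 ?sqr_ge0 // ltW.
have /andP[c0 c1] := fraction_density_bounds; have cz := fraction_density_zeta2.
have mc : c * m%:R ^+ 2 * m%:R^-1 <= m%:R.
  by rewrite expr2 mulrA mulfK ?gt_eqF // ler_piMl // ?ltW //; lra.
case/andP: e2 => e2 e2'.
have cm0 : 0 <= c * m%:R ^+ 2 by rewrite mulr_ge0 ?sqr_ge0 // ltW.
have u1 := ler_wpM2l cm0 e2; have u2 := ler_wpM2l cm0 e2'.
have cz2 : c * m%:R ^+ 2 * (pi ^+ 2 / 6) = m%:R ^+ 2 / 2.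
  by rewrite mulrAC cz mulrC.
rewrite cz2 in u1 u2.
have u3 : (eta + kappa) * m%:R ^+ 2 * s <= 3 / 4 * (17 / 16 * eta) * m%:R ^+ 2.
  have -> : eta + kappa = 17 / 16 * eta by rewrite /kappa; field.
  rewrite -[leRHS]mulrA [leRHS]mulrC ler_wpM2l //.
  by rewrite mulr_ge0 ?sqr_ge0 // mulr_ge0 // ltW.
have u4 : 0 <= eta * m%:R ^+ 2 by rewrite mulr_ge0 ?sqr_ge0 // ltW.
have hk : kappa * m%:R ^+ 2 = eta * m%:R ^+ 2 / 16 by rewrite /kappa; ring.
rewrite hk in hB.
rewrite /B in hB *.
move: e3; rewrite !ler_norml => /andP[v1 v2].
move: (3 / pi ^+ 2 : R) (pi ^+ 2 / 6 : R) => cc zz in v1 v2 c0 c1 cz mc cm0 u1 u2 cz2 e2 e2' *.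
apply/andP; split; lra.
Qed.

Lemma quad_approx_exists eta : 0 < eta -> exists C, 0 <= C /\
  forall (Phi : nat -> nat) n,
   (forall m, (m <= n)%N -> \sum_(1 <= j < m.+1) Phi (m %/ j) = \sum_(1 <= k < m.+1) k)%N ->
   quad_approx Phi n eta C.
Proof.
move=> eta0.
(* An explicit decay rate, from which a [t] with [(7 / 8) ^+ t <= eta] is extracted. *)
have pw t : (7 / 8) ^+ t * (1 + t%:R / 8) <= 1 :> R.
  elim: t => [|t IHt]; first by rewrite mul0r addr0 mul1r.
  apply: le_trans IHt; rewrite exprS -mulrA [7 / 8 * _]mulrCA ler_wpM2l ?exprn_ge0 //.
  rewrite -natr1; have : 0 <= t%:R :> R by []. by lra.
have [t ht] : exists t : nat, (7 / 8) ^+ t <= eta.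
  have := archi_boundP (divr_ge0 (ler0n R 8) (ltW eta0)); set t := Num.bound _ => ht.
  exists t; rewrite -(ler_pM2r (_ : 0 < 1 + t%:R / 8)); last by rewrite ltr_pwDl // divr_ge0.
  apply: le_trans (pw t) _; move: ht; rewrite ltr_pdivrMr // => ht.
  by rewrite mulrDr mulr1; lra.
suff [C [C0 HC]] : exists C, 0 <= C /\ forall (Phi : nat -> nat) n,
   (forall m, (m <= n)%N -> \sum_(1 <= j < m.+1) Phi (m %/ j) = \sum_(1 <= k < m.+1) k)%N ->
   quad_approx Phi n ((7 / 8) ^+ t) C.
  exists C; split=> // Phi n rec m mn; apply: le_trans (HC _ _ rec _ mn) _.
  by rewrite lerD2r ler_wpM2r ?sqr_ge0.
elim: t {ht} => [|t [C [C0 HC]]].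
  (* The iteration starts at [eta = 1], [C = 0]: both [Phi m] and [c * m ^ 2] lie between 0 and
     [m ^ 2]. *)
  exists 0; split=> // Phi n rec m /andP[m0 mn]; rewrite expr0 mul1r addr0.
  have := rec m mn; rewrite big_ltn // divn1 => e.
  have le1 : (Phi m)%:R <= m%:R ^+ 2 :> R.
    have le2 : (Phi m <= \sum_(1 <= k < m.+1) k)%N by rewrite -e leq_addr.
    rewrite -natrX ler_nat; apply: leq_trans le2 _.
    rewrite -mulnn -[X in (_ <= X * _)%N]subn0 -subSS -sum_nat_const_nat.
    by rewrite big_nat_cond [leqRHS]big_nat_cond leq_sum // => k; lia.
  have /andP[c0 c1] := fraction_density_bounds.
  have := sqr_ge0 (m%:R : R); have := ler0n R (Phi m).
  rewrite ler_norml; move: (3 / pi ^+ 2 : R) c0 c1 => cc *; apply/andP; split; nra.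
have e0 : 0 < (7 / 8) ^+ t :> R by rewrite exprn_gt0.
have [C' [C'0 HC']] := quad_approx_step e0 C0.
by exists C'; split=> // Phi n rec; rewrite exprS; apply: HC' => //; apply: HC.
Qed.

End QuadraticGrowth.

(** * Mean and variance of the degree *)

Lemma le_bprob (R : realType) n (alpha : R) (E E' : pred {set 'I_n}) :
  0 <= alpha <= 1 -> (forall S, E S -> E' S) -> bprob alpha E <= bprob alpha E'.
Proof.
move=> a01 EE'; rewrite /bprob big_mkcond [leRHS]big_mkcond; apply: ler_sum => S _.
case: ifP => [/EE' -> //|_]; case: ifP => // _; exact: bweight_ge0.
Qed.

Section Assembly.
Variable R : realType.
Local Notation c := (3 / pi ^+ 2 : R).

(** Dividing the dilogarithm series by [1 - alpha] lowers each exponent by one, which gives a form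
    that also covers [alpha = 1]. *)
Lemma fdens_bounds (alpha : R) n : 0 < alpha <= 1 -> (0 < n)%N ->
  c * alpha * \sum_(0 <= j < n) (1 - alpha) ^+ j / j.+1%:R ^+ 2 <= fdens alpha
    <= c * alpha * (\sum_(0 <= j < n) (1 - alpha) ^+ j / j.+1%:R ^+ 2 + n%:R^-1).
Proof.
move=> /andP[a0 a1]; case: n => // n _; set s := \sum_(0 <= j < n.+1) _; rewrite /fdens.
have /andP[c0 _] := fraction_density_bounds R.
have ca0 : 0 < c * alpha by rewrite mulr_gt0.
case: eqVneq => [a1'|an1].
  (* Only [j = 0] survives, through [0 ^+ 0 = 1]. *)
  have -> : s = 1.
    rewrite /s big_ltn // expr0 expr1n divr1 big_nat_cond big1 ?addr0 // => j /andP[/andP[j0 _] _].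
    by rewrite a1' subrr expr0n gtn_eqF // mul0r.
  by rewrite a1' !mulr1 lexx ler_peMr ?(ltW c0) // lerDl invr_ge0.
set b := 1 - alpha in s *.
have b0 : 0 < b by rewrite subr_gt0 lt_neqAle an1.
have b1 : b <= 1 by rewrite /b; lra.
have := @Li2_bounds R b n; rewrite b1 (ltW b0) => /(_ isT).
have -> : \sum_(0 <= k < n.+1) b ^+ k.+1 / k.+1%:R ^+ 2 = b * s.
  by rewrite mulr_sumr; apply: eq_bigr => k _; rewrite exprS mulrA.
rewrite -mulrDr => /andP[h1 h2].
have -> : c * (alpha * Li2 b / b) = c * alpha * (Li2 b / b) by rewrite !mulrA.
rewrite !ler_pM2l //.
by rewrite ler_pdivlMr // mulrC h1 ler_pdivrMr // [_ * b]mulrC.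
Qed.

Lemma fdens_ge (alpha : R) : 0 < alpha <= 1 -> c * alpha <= fdens alpha.
Proof.
move=> a01; have /andP[+ _] := @fdens_bounds alpha 1 a01 isT.
by rewrite big_nat1 expr0 expr1n divr1 mulr1.
Qed.

Variables (n : nat) (alpha : R).
Hypotheses (n0 : (0 < n)%N) (a01 : 0 < alpha <= 1).
Local Notation N := n`!.
Local Notation beta := (1 - alpha).

(** For [i] non-zero, the points whose selection makes the [i]-th power of a primitive [N]-th root
    of unity a root of the lcm. *)
Definition hits (i : nat) : {set 'I_n} := [set k : 'I_n | (N %| i * k.+1)%N].

Lemma card_hits i : #|hits i| = (n %/ denom N i)%N.
Proof.
rewrite divn_count_dvd big_add1 big_mkord -sum1_card big_mkcond /=.
by apply: eq_bigr => k _; rewrite inE denom_dvd ?fact_gt0 //; case: dvdn.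
Qed.

Lemma Xdeg_hits (S : {set 'I_n}) :
  (Xdeg S)%:R = \sum_(i < N | i != 0 :> nat) (~~ [disjoint S & hits i])%:R :> R.
Proof.
rewrite (XdegE S (fact_gt0 n) (fun k => @dvdn_fact k n)) -sum1_card natr_sum.
rewrite big_mkcond [RHS]big_mkcond /=; apply: eq_bigr => i _; rewrite inE.
case: eqP => //= _.
have -> : [exists k : 'I_n, (k \in S) && (N %| i * k.+1)%N] = ~~ [disjoint S & hits i].
  by apply/existsP/pred0Pn => -[k]; [|]; exists k; move: p; rewrite /= inE.
by case: disjoint.
Qed.

(** The expectation of [Xdeg], by [Xdeg_hits] and [bexp_disjoint]. *)
Definition Xmean : R := \sum_(i < N | i != 0 :> nat) (1 - beta ^+ #|hits i|).

(** Expand [1 - beta ^+ a] as a geometric sum over [j < a] and exchange the sums: [j < #|hits i|]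
    holds exactly when [denom N i <= n %/ j.+1]. *)
Lemma Xmean_count :
  Xmean = alpha * \sum_(0 <= j < n) beta ^+ j * ((count_denom N (n %/ j.+1))%:R - 1).
Proof.
have geo a : (a <= n)%N -> 1 - beta ^+ a = alpha * \sum_(0 <= j < n) beta ^+ j * (j < a)%:R.
  move=> an; have -> : \sum_(0 <= j < n) beta ^+ j * (j < a)%:R = \sum_(0 <= j < a) beta ^+ j.
    rewrite (big_cat_nat _ (n := a)) //= [X in _ + X]big_nat_cond.
    rewrite [X in _ + X]big1 ?addr0 => [|j /andP[/andP[aj _] _]].
      by apply: eq_big_nat => j /= ->; rewrite mulr1.
    by rewrite ltnNge aj mulr0.
  by rewrite big_mkord -[LHS]opprB subrX1 -mulNr; congr (_ * _); ring.
have hn i : (#|hits i| <= n)%N by rewrite -[leqRHS]card_ord max_card.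
rewrite /Xmean (eq_bigr _ (fun (i : 'I_N) _ => geo _ (hn i))).
rewrite -mulr_sumr exchange_big /=; congr (_ * _).
apply: eq_big_nat => j /andP[_ jn]; rewrite -mulr_sumr; congr (_ * _).
have q0 : (0 < n %/ j.+1)%N by rewrite divn_gt0.
have hj (i : 'I_N) : (j < #|hits i|)%N = (denom N i <= n %/ j.+1)%N.
  by rewrite card_hits leq_divRL ?denom_gt0 ?fact_gt0 // leq_divRL // mulnC.
rewrite /count_denom big_mkord natr_sum (eq_bigr _ (fun i _ => congr1 (fun b : bool => b%:R) (hj i))).
(* The index 0 has denominator 1, so [count_denom] counts it while [Xmean] omits it; hence the
   [- 1]. *)
have N0 := fact_gt0 n; pose o : 'I_N := Ordinal N0.
rewrite [in RHS](bigD1 o) //= /denom gcdn0 divnn N0 q0 addrAC subrr add0r.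
exact: eq_bigl.
Qed.

(** Using [kappa = eta] gives [2 * eta], doubled since the inverse squares sum to at most 2. In the
    linear term, one 1 comes from the [- 1] in [Xmean_count] and the other from truncating the
    series of [fdens]. The factor [alpha] is kept because [fdens alpha] is itself at least
    [c * alpha]. *)
Lemma Xmean_approx eta C : 0 < eta -> 0 <= C ->
  quad_approx (count_denom N) n eta C ->
  `|Xmean - fdens alpha * n%:R ^+ 2|
    <= alpha * (4 * eta * n%:R ^+ 2 + (C + eta^-1 + 2) * n%:R).
Proof.
move=> eta0 C0 Hq; have /andP[a0 a1] := a01.
have nr : 0 < n%:R :> R by rewrite ltr0n.
have b0 : 0 <= beta by rewrite subr_ge0.
have b1 : beta <= 1 by lra.
have /andP[c0 c1] := fraction_density_bounds R.
have := fdens_bounds a01 n0; set s := \sum_(0 <= j < n) _ => /andP[f1 f2].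
have main : `|Xmean - c * alpha * s * n%:R ^+ 2|
    <= alpha * (4 * eta * n%:R ^+ 2 + (C + eta^-1 + 1) * n%:R).
  have -> : c * alpha * s * n%:R ^+ 2 =
      alpha * \sum_(0 <= j < n) beta ^+ j * (c * (n%:R / j.+1%:R) ^+ 2).
    transitivity (alpha * (c * n%:R ^+ 2 * s)); first by ring.
    congr (_ * _); rewrite mulr_sumr; apply: eq_bigr => j _.
    by rewrite exprMn exprVn; ring.
  rewrite Xmean_count -mulrBr -sumrB normrM (gtr0_norm a0) ler_pM2l //.
  apply: le_trans (ler_norm_sum _ _ _) _.
  apply: le_trans (_ : _ <= \sum_(0 <= j < n)
     (2 * eta * n%:R ^+ 2 * j.+1%:R ^- 2 + (C + eta^-1 + 1))) _.
    apply: ler_sum_nat => j /andP[_ jn].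
    rewrite -mulrBr normrM ger0_norm ?exprn_ge0 //.
    apply: le_trans (_ : 1 * `|(count_denom N (n %/ j.+1))%:R - 1 - c * (n%:R / j.+1%:R) ^+ 2| <= _).
      by rewrite ler_wpM2r // exprn_ile1.
    rewrite mul1r addrAC; apply: le_trans (ler_normB _ _) _; rewrite normr1 addrA lerD2r.
    have := quad_approx_div (ltW eta0) eta0 Hq (_ : 0 < j.+1 <= n)%N (leqnn n).
    move=> /(_ jn) /le_trans; apply; rewrite exprMn exprVn !mulrA.
    by rewrite -mulr2n mulr_natl addrA.
  rewrite big_split /= sumr_const_nat subn0 -mulr_sumr -[(_ + 1) *+ _]mulr_natr lerD2r.
  have s2 : \sum_(0 <= j < n) j.+1%:R ^- 2 <= 2 :> R.
    have := sum_invsqr_from2_le R n; rewrite -[\sum_(0 <= j < n) _](big_add1 _ _ 0 n.+1 xpredT (fun j => j%:R ^- 2)).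
    by rewrite [in X in _ -> X]big_ltn // expr1n invr1; lra.
  have -> : 4 * eta * n%:R ^+ 2 = 2 * eta * n%:R ^+ 2 * 2 by ring.
  by rewrite ler_wpM2l // !mulr_ge0 ?sqr_ge0 // ltW.
have fd : `|c * alpha * s * n%:R ^+ 2 - fdens alpha * n%:R ^+ 2| <= alpha * n%:R.
  rewrite -mulrBl normrM [`|n%:R ^+ 2|]ger0_norm ?sqr_ge0 //.
  apply: le_trans (_ : (c * alpha / n%:R) * n%:R ^+ 2 <= _).
    rewrite ler_wpM2r ?sqr_ge0 // distrC ger0_norm ?subr_ge0 // lerBlDl.
    by rewrite -mulrDr.
  rewrite expr2 mulrA divfK ?gt_eqF // ler_wpM2r ?(ltW nr) //.
  by rewrite ler_piMl ?(ltW a0) //; lra.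
apply: le_trans (ler_distD (c * alpha * s * n%:R ^+ 2) _ _) _.
apply: le_trans (lerD main fd) _; rewrite -mulrDr ler_pM2l //; lra.
Qed.

(** A point [k] lies in [hits i] for exactly [k.+1 <= n] indices [i < N], so each of the [n] squared
    multiplicities is at most [n ^ 2]. *)
Lemma Xvar_le :
  bexp alpha (fun S : {set 'I_n} => ((Xdeg S)%:R - Xmean) ^+ 2) <= alpha * n%:R ^+ 3.
Proof.
have a01' : 0 <= alpha <= 1 by case/andP: a01 => /ltW -> ->.
rewrite (eq_bexp _ (fun S : {set 'I_n} => congr1 (fun x => (x - Xmean) ^+ 2) (Xdeg_hits S))).
apply: le_trans (var_hit_le a01' _ _) _; rewrite ler_wpM2l //; first by case/andP: a01'.
have -> : n%:R ^+ 3 = \sum_(k < n) n%:R ^+ 2 :> R.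
  by rewrite sumr_const card_ord exprS mulr_natl.
apply: ler_sum => k _; rewrite ler_sqr ?nnegrE ?sumr_ge0 //.
rewrite -natr_sum ler_nat.
have kN : (k.+1 %| N)%N by rewrite dvdn_fact //= ltn_ord.
apply: leq_trans (ltn_ord k); rewrite -(sum_mul_dvdn (fact_gt0 n) kN) big_mkord.
by rewrite big_mkcond leq_sum // => i _; rewrite inE; case: ifP.
Qed.

End Assembly.

Theorem theorem1p4 (R : realType) (eps delta : R) :
  0 < eps -> 0 < delta ->
  exists M : R, 0 < M /\
    forall (n : nat) (alpha : R), (0 < n)%N -> 0 < alpha <= 1 ->
      M <= alpha * n%:R ->
      @bprob R n alpha (fun S => eps * fdens alpha * n%:R ^+ 2 <
                              `| (Xdeg S)%:R - fdens alpha * n%:R ^+ 2 |)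
      <= delta.
Proof.
move=> e0 d0; have /andP[c0 _] := fraction_density_bounds R; set c := 3 / pi ^+ 2 in c0.
(* Half of the allowed deviation goes to the bias of the mean. Then [4 * eta = eps * c / 4] takes
   half of that, leaving the other half for the linear term. *)
pose eta := eps * c / 16; have eta0 : 0 < eta by rewrite divr_gt0 // mulr_gt0.
have [C [C0 HC]] := quad_approx_exists eta0.
pose C' := C + eta^-1 + 2; have C'0 : 0 < C'.
  have : 0 < eta^-1 by rewrite invr_gt0.
  by rewrite /C'; lra.
(* The first summand makes the linear term [C' * n] at most [eps * c / 4 * n ^ 2]; the second makes
   the Chebyshev quotient at most [delta]. *)
pose M := 4 * C' / (eps * c) + 4 / ((eps * c) ^+ 2 * delta).
have ec0 : 0 < eps * c by rewrite mulr_gt0.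
have M1 : 0 < 4 * C' / (eps * c) by apply: divr_gt0 => //; apply: mulr_gt0.
have M2 : 0 < 4 / ((eps * c) ^+ 2 * delta).
  by apply: divr_gt0 => //; apply: mulr_gt0 => //; apply: exprn_gt0.
exists M; split; first by rewrite addr_gt0.
move=> n alpha n0 a01 hM; have /andP[a0 a1] := a01.
have nr : 0 < n%:R :> R by rewrite ltr0n.
have an : alpha * n%:R <= n%:R by rewrite ler_piMl // ltW.
have F1 := fdens_ge a01; rewrite -/c in F1.
set F := fdens alpha * n%:R ^+ 2.
have F0 : c * alpha * n%:R ^+ 2 <= F by rewrite ler_wpM2r ?sqr_ge0.
have cF0 : 0 < c * alpha * n%:R ^+ 2 by apply: mulr_gt0; [exact: mulr_gt0 | exact: exprn_gt0].
have mean : `|Xmean n alpha - F| <= eps * F / 2.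
  apply: le_trans (Xmean_approx n0 a01 eta0 C0 (HC _ _ _)) _.
    by move=> m; apply: count_denom_sum; rewrite ?fact_gt0 // => k; exact: dvdn_fact.
  rewrite -/C'; apply: le_trans (_ : eps * (c * alpha * n%:R ^+ 2) / 2 <= _); last first.
    by rewrite ler_pM2r // ler_pM2l.
  have h : C' * n%:R <= eps * c / 4 * n%:R ^+ 2.
    rewrite expr2 mulrA ler_pM2r //.
    have : 4 * C' / (eps * c) <= n%:R by move: hM; rewrite /M; lra.
    by rewrite ler_pdivrMr //; lra.
  have -> : eps * (c * alpha * n%:R ^+ 2) / 2 = alpha * (eps * c / 2 * n%:R ^+ 2) by field.
  by rewrite ler_pM2l // /eta; lra.
have t0 : 0 < eps * F / 2 by rewrite divr_gt0 // mulr_gt0 // (lt_le_trans cF0).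
have a01' : 0 <= alpha <= 1 by rewrite ltW.
(* As the mean is within [eps * F / 2] of [F], a deviation above [eps * F] from [F] forces one above
   [eps * F / 2] from the mean. *)
apply: le_trans (_ : bprob alpha (fun S => eps * F / 2 < `|(Xdeg S)%:R - Xmean n alpha|) <= _).
  apply: le_bprob => // S; rewrite -/F -mulrA -/F => h.
  have := ler_distD (Xmean n alpha) (Xdeg S)%:R F; lra.
apply: le_trans (chebyshev_bprob a01' (fun S : {set 'I_n} => (Xdeg S)%:R) (Xmean n alpha) t0) _.
rewrite ler_pdivrMr ?exprn_gt0 //; apply: le_trans (Xvar_le n a01) _.
apply: le_trans (_ : delta * (eps * (c * alpha * n%:R ^+ 2) / 2) ^+ 2 <= _); last first.
  have h0 : 0 <= eps * (c * alpha * n%:R ^+ 2) / 2.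
    by apply: divr_ge0 => //; apply: mulr_ge0; exact: ltW.
  by rewrite ler_pM2l // ler_sqr ?nnegrE ?(ltW t0) // ler_pM2r // ler_pM2l.
(* This is the inequality [alpha * n ^ 3 <= delta * (eps * c * alpha * n ^ 2 / 2) ^ 2] after
   division by [alpha * n ^ 3 / 4]. *)
have hd : 4 <= alpha * n%:R * ((eps * c) ^+ 2 * delta).
  rewrite -ler_pdivrMr; last by apply: mulr_gt0 => //; apply: exprn_gt0.
  by apply: le_trans hM; rewrite /M lerDr ltW.
have -> : delta * (eps * (c * alpha * n%:R ^+ 2) / 2) ^+ 2 = alpha * n%:R ^+ 3 * (alpha * n%:R * ((eps * c) ^+ 2 * delta) / 4) by field.
apply: ler_peMr; last by rewrite ler_pdivlMr // mul1r.
by apply: mulr_ge0; [exact: ltW | exact: exprn_ge0].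
Qed.
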